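(* Let $A$ and $B$ be elongated ribbons of the same size. Then $\mathrm{supp}_F(A) \supseteq \mathrm{supp}_F(B)$ if and only if $\mathrm{rows}_k(A) \preceq \mathrm{rows}_k(B)$ for all $k\ge 1$.
   Context: A composition of $n$ is a sequence of positive integers with sum $n$; a partition is a weakly decreasing composition. Compositions $\alpha=(\alpha_1,\dots,\alpha_k)$ of $n$ correspond bijectively to subsets of $[n-1]=\{1,\dots,n-1\}$ via $S(\alpha)=\{\alpha_1,\alpha_1+\alpha_2,\dots,\alpha_1+\cdots+\alpha_{k-1}\}$. Young diagrams are left-justified with row $1$ at the top; a skew shape $\lambda/\mu$ is the Young diagram of $\lambda$ with the boxes of $\mu\subseteq\lambda$ removed from its top-left. The size of a skew shape is its number of boxes. A ribbon is a skew shape in which every pair of adjacent rows overlap in exactly one column. A ribbon is elongated if all its rows have length at least two. A standard Young tableau (SYT) of a skew shape $A$ with $n$ boxes is a filling of the boxes by $1,\dots,n$, each used once, increasing left to right along rows and down columns. Its descent set is the set of $i$ such that $i+1$ appears in a strictly lower row than $i$, and its descent composition is the composition of $n$ corresponding to its descent set. The monomial quasisymmetric functions are $M_\alpha=\sum_{i_1<\cdots<i_k}x_{i_1}^{\alpha_1}\cdots x_{i_k}^{\alpha_k}$, and the fundamental quasisymmetric functions are $F_\alpha=\sum_{S(\alpha)\subseteq S(\beta)\subseteq[n-1]}M_\beta$ for $\alpha$ of size $n$. The skew Schur function is $s_A=\sum_T F_{\mathrm{comp}(T)}$, the sum being over all SYT $T$ of shape $A$, where $\mathrm{comp}(T)$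 is the descent composition of $T$. The $F$-support $\mathrm{supp}_F(A)$ is the set of compositions $\alpha$ such that $F_\alpha$ has positive coefficient in $s_A$ (equivalently, such that some SYT of shape $A$ has descent composition $\alpha$). For a skew shape $A$ with $r$ rows and $1\le i\le r-k+1$, let $\mathrm{overlap}_k(i)$ be the number of columns occupied in common by rows $i,i+1,\dots,i+k-1$; $\mathrm{rows}_k(A)$ is the partition obtained by sorting $(\mathrm{overlap}_k(1),\dots,\mathrm{overlap}_k(r-k+1))$ into weakly decreasing order and omitting zeros (so it is the empty partition if there are no nonzero overlaps). Dominance order, for partitions possibly of different sizes: $\lambda=(\lambda_1,\dots,\lambda_r)\preceq\mu=(\mu_1,\dots,\mu_s)$ if $\lambda_1+\cdots+\lambda_k\le\mu_1+\cdots+\mu_k$ for all $k=1,\dots,r$, where $\mu_i=0$ for $i>s$. *)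

(* Defs.v *)
From HB Require Import structures.
From mathcomp Require Import all_boot all_order all_algebra.
From mathcomp Require Import finmap.

Set Implicit Arguments.
Unset Strict Implicit.
Unset Printing Implicit Defensive.

Import GRing.Theory Num.Theory.

(** * Compositions and partitions *)

(* A composition a is a composition of [sumn a]. *)
Definition is_comp (a : seq nat) : bool := 0 \notin a.

Definition is_part (la : seq nat) : bool := sorted geq la && is_comp la.

(* The subsets of [n-1] = {1, ..., n-1} are represented by {set 'I_n.-1},
   with i : 'I_n.-1 standing for the integer i.+1. *)

(* [scanl addn 0 a] is a_1, a_1 + a_2, ..., n; the last term n is never of the
   form i.+1 with i < n.-1. *)
Definition set_of_comp (n : nat) (a : seq nat) : {set 'I_n.-1} :=
  [set i : 'I_n.-1 | i.+1 \in scanl addn 0 a].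

(* Inverse of [set_of_comp n] on compositions of n: if D = {d_1 < ... < d_k},
   this is (d_1, d_2 - d_1, ..., n - d_k).  For n = 0 the only composition is
   the empty one. *)
Definition comp_of_set (n : nat) (D : {set 'I_n.-1}) : seq nat :=
  if n == 0 then [::] else
  pairmap (fun x y => y - x) 0 (rcons [seq (val i).+1 | i <- enum D] n).

(* Extra terms of mu (when mu is longer than la) are ignored; [take k mu] is mu
   when mu has fewer than k parts. *)
Definition dom_le (la mu : seq nat) : Prop :=
  forall k, 1 <= k <= size la -> sumn (take k la) <= sumn (take k mu).

(** * Skew shapes *)

Record skew_shape := SkewShape {
  outer : seq nat;
  inner : seq nat;
  outer_part : is_part outer;
  inner_part : is_part inner;
  inner_sub_outer : forall i, nth 0 inner i <= nth 0 outer i }.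

(* Rows and columns are numbered from 0; row 0 is the top row. *)
Definition boxes (A : skew_shape) : seq (nat * nat) :=
  [seq (i, j) | i <- iota 0 (size (outer A)),
                j <- iota (nth 0 (inner A) i)
                          (nth 0 (outer A) i - nth 0 (inner A) i)].

Definition box (A : skew_shape) : finType := seq_sub (boxes A).

Definition brow (A : skew_shape) (b : box A) : nat := (val b).1.
Definition bcol (A : skew_shape) (b : box A) : nat := (val b).2.

Definition shape_size (A : skew_shape) : nat := #|box A|.

Definition nrows (A : skew_shape) : nat := size (outer A).

(* Number of columns occupied in common by the k rows i, ..., i + k - 1. *)
Definition overlap (k : nat) (A : skew_shape) (i : nat) : nat :=
  count (fun j => all (fun l => (l, j) \in boxes A) (iota i k))
        (iota 0 (head 0 (outer A))).

(* With rows numbered from 0, the admissible i are 0 <= i < r + 1 - k. *)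
Definition rows_part (k : nat) (A : skew_shape) : seq nat :=
  sort geq [seq d <- [seq overlap k A i | i <- iota 0 (nrows A + 1 - k)] | 0 < d].

Definition ribbon (A : skew_shape) : Prop :=
  forall i, i.+1 < nrows A -> overlap 2 A i = 1.

Definition row_length (A : skew_shape) (i : nat) : nat :=
  nth 0 (outer A) i - nth 0 (inner A) i.

Definition elongated_ribbon (A : skew_shape) : Prop :=
  ribbon A /\ forall i, i < nrows A -> 2 <= row_length A i.

(** * Standard Young tableaux *)

(* A filling T with values in 'I_n (n the size of A) puts the entry (T b).+1
   in the box b. *)
Definition filling (A : skew_shape) := {ffun box A -> 'I_(shape_size A)}.

Definition entry (A : skew_shape) (T : filling A) (b : box A) : nat := (T b).+1.

Definition is_SYT (A : skew_shape) (T : filling A) : bool :=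
  [&& [forall v, #|[pred b | T b == v]| == 1],
      [forall b, forall b', (brow b == brow b') && (bcol b < bcol b')
                            ==> (entry T b < entry T b')]
    & [forall b, forall b', (bcol b == bcol b') && (brow b < brow b')
                            ==> (entry T b < entry T b')]].

Definition descent_set (A : skew_shape) (T : filling A) :
    {set 'I_(shape_size A).-1} :=
  [set i : 'I_(shape_size A).-1 |
    [exists b, exists b', [&& entry T b == i.+1, entry T b' == i.+2
                            & brow b < brow b']]].

Definition descent_comp (A : skew_shape) (T : filling A) : seq nat :=
  comp_of_set (descent_set T).

(** * Quasisymmetric functions *)

(* Formal power series over int in the variables x_0, x_1, ...: a monomial is
   its finitely supported exponent function, a series its coefficient function. *)
Definition monomial := {fsfun nat -> nat with 0}.
Definition series := monomial -> int.

Definition exponents (m : monomial) : seq nat :=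
  [seq m i | i <- sort leq (finsupp m)].

(* x_{i_1}^{a_1} ... x_{i_k}^{a_k} with i_1 < ... < i_k occurs exactly once in
   M_a, and nothing else does. *)
Definition Mqsym (a : seq nat) : series :=
  fun m => ((exponents m == a)%:R)%R.

Definition Fqsym (a : seq nat) : series := fun m =>
  (\sum_(D : {set 'I_(sumn a).-1} | set_of_comp (sumn a) a \subset D)
     Mqsym (comp_of_set D) m)%R.

Definition skew_schur (A : skew_shape) : series := fun m =>
  (\sum_(T : filling A | is_SYT T) Fqsym (descent_comp T) m)%R.

(* c is the family of coefficients of an expansion of f as a finite linear
   combination of the F_a, a ranging over compositions. *)
Definition F_expansion (f : series) (c : {fsfun seq nat -> int with 0%R}) : Prop :=
  (forall a, a \in finsupp c -> is_comp a) /\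
  (forall m, f m = (\sum_(a <- finsupp c) c a * Fqsym a m)%R).

Definition F_support (A : skew_shape) (a : seq nat) : Prop :=
  exists2 c, F_expansion (skew_schur A) c & (0 < c a)%R.

(* Main.v *)
Require Import Defs.
From mathcomp Require Import all_boot all_algebra finmap zify.

Set Implicit Arguments.
Unset Strict Implicit.
Unset Printing Implicit Defensive.

(** Recording the row of each entry turns an SYT of an elongated ribbon with row
lengths [b] into a word with [b_i] letters [i] in which, for every [i], some [i]
precedes some [i.+1]; descents of the tableau are the strict ascents of the word.
So the support of the ribbon is the collection of ascent sets of such words.

Containment from dominance.  If [b_i > b_{i+1}], a crystal operator changes a
letter [i] into [i.+1] without changing the ascent set; only the condition for
[i.-1] and [i] can be lost, and it can be repaired because every letter occurs at
least twice.  Hence the ascent set of a word with content [b] is also realised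
with [b_i, b_{i+1}] replaced by any two numbers between them having the same
sum.  These moves permute [b] and lead to every sequence dominated by it.

Dominance from containment.  Let [v] be the concatenation over [k] of the
increasing words on [{i | b_i > k}].  A word with the same ascents and content
[a] has each letter at most [k] times among the letters of the first [k] runs, so
[\sum min(k, b_i) <= \sum min(k, a_i)], which is dominance for the conjugates.
The number of rows is compared by a word with a single ascent, whose last
weakly decreasing block is [r-1, ..., 1], where [r] is the length of [b]. *)

(** * Words and the crystal operator *)

Definition occ (u : nat -> nat) (l n : nat) : nat := \sum_(p < n) (u p == l).

Lemma occ0 u l : occ u l 0 = 0.
Proof. exact: big_ord0. Qed.

Lemma occS u l n : occ u l n.+1 = occ u l n + (u n == l).
Proof. exact: big_ord_recr. Qed.

Lemma occ_count u l n : occ u l n = count_mem l (mkseq u n).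
Proof.
elim: n => [|n IH]; first by rewrite occ0.
by rewrite occS IH mkseqS -cats1 count_cat /= addn0.
Qed.

Lemma leq_occ u l m n : m <= n -> occ u l m <= occ u l n.
Proof.
elim: n => [|n IH]; first by rewrite leqn0 => /eqP->.
rewrite leq_eqVlt => /orP[/eqP->//|]; rewrite ltnS => /IH.
by rewrite occS; lia.
Qed.

Lemma occ_ltP u l m n : occ u l m < occ u l n ->
  exists p, [/\ m <= p, p < n & u p = l].
Proof.
elim: n => [|n IH]; first by rewrite occ0.
rewrite occS => h; case: (ltnP (occ u l m) (occ u l n)) => [/IH[p [h1 h2 h3]]|h'].
  by exists p; split=> //; lia.
exists n; split=> //; last by case: (eqVneq (u n) l) h => // _ h; lia.
rewrite leqNgt; apply/negP => hm; have := @leq_occ u l n.+1 m hm; rewrite occS; lia.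
Qed.

Lemma occ_gt_size u l n (s : seq nat) : size s < occ u l n ->
  exists p, [/\ p < n, u p = l & p \notin s].
Proof.
have -> : occ u l n = size [seq p <- iota 0 n | u p == l].
  by rewrite size_filter occ_count /mkseq count_map.
move=> h.
case: (boolP (all [in s] [seq p <- iota 0 n | u p == l])) => [/allP hs|/allPn[p]].
  by have := leq_trans h (uniq_leq_size (filter_uniq _ (iota_uniq 0 n)) hs); rewrite ltnn.
by rewrite mem_filter mem_iota => /andP[/eqP h1 /andP[_ h2]] h3; exists p.
Qed.

(** The function minimised is the difference [f - g], compared through cross sums because
    subtraction on [nat] truncates. Strictness to the right makes [j] its last minimiser. *)
Lemma last_argmin (f g : nat -> nat) n : exists2 j, j <= n &
  forall p, p <= n ->
    f j + g p <= f p + g j /\ (j < p -> f j + g p < f p + g j).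
Proof.
elim: n => [|n [j hj H]].
  by exists 0 => // p; rewrite leqn0 => /eqP->.
case: (leqP (f n.+1 + g j) (f j + g n.+1)) => h.
  exists n.+1 => // p; rewrite leq_eqVlt => /orP[/eqP->|]; first by split; lia.
  by rewrite ltnS => hp; have [] := H p hp; lia.
exists j => [|p]; first lia.
by rewrite leq_eqVlt => /orP[/eqP->|]; [split; lia|rewrite ltnS => /H].
Qed.

Lemma last_such (P : pred nat) n : (exists2 p, p < n & P p) ->
  exists x, [/\ x < n, P x & forall p, p < n -> P p -> p <= x].
Proof.
move=> [p0 h0 hP].
have ex : exists p, (p < n) && P p by exists p0; rewrite h0.
have ub : forall p, (p < n) && P p -> p <= n by move=> p /andP[/ltnW].
case: (ex_maxnP ex ub) => x /andP[h1 h2] h3; exists x; split=> // p hp hPp.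
by apply: h3; rewrite hp.
Qed.

Lemma first_such (P : pred nat) n : (exists2 p, p < n & P p) ->
  exists x, [/\ x < n, P x & forall p, P p -> x <= p].
Proof.
move=> [p0 h0 hP].
case: (ex_minnP (ex_intro _ p0 hP)) => x h1 h2; exists x; split=> //.
exact: leq_ltn_trans (h2 _ hP) h0.
Qed.

Lemma run_start (u : nat -> nat) x : exists z, [/\ z <= x,
  forall p, z <= p <= x -> u p = u x & forall p, p.+1 = z -> u p <> u x].
Proof.
elim: x => [|x [z [h1 h2 h3]]].
  by exists 0; split=> // p; rewrite leqn0 => /eqP->.
case: (eqVneq (u x) (u x.+1)) => [e|/eqP e].
  exists z; split; [lia| |by rewrite -e].
  move=> p; case: (eqVneq p x.+1) => [->//|h] hp.
  by rewrite h2 ?e //; lia.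
exists x.+1; split=> // [p hp|p [->]//].
by have -> : p = x.+1 by lia.
Qed.

Definition upd (u : nat -> nat) j v p := if p == j then v else u p.

Lemma upd_eq u j v : upd u j v j = v.
Proof. by rewrite /upd eqxx. Qed.

Lemma upd_neq u j v p : p <> j -> upd u j v p = u p.
Proof. by rewrite /upd => /eqP/negbTE->. Qed.

Lemma occ_upd u j v l n :
  occ (upd u j v) l n + (j < n) * (u j == l) = occ u l n + (j < n) * (v == l).
Proof.
elim: n => [|n IH]; first by rewrite !occ0.
rewrite !occS; case: (eqVneq n j) => [e|e].
  by subst n; move: IH; rewrite upd_eq ltnn ltnSn; lia.
by rewrite upd_neq; [move: IH; lia|exact/eqP].
Qed.

(* Exchanging the adjacent values [i] and [i.+1] at [j] can only affect a
   comparison with a neighbour carrying the other one of the two values. *)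
Lemma asc_upd u j i v n :
  (u j = i /\ v = i.+1) \/ (u j = i.+1 /\ v = i) ->
  (forall p, p.+1 = j -> u p <> i) -> (j.+1 < n -> u j.+1 <> i.+1) ->
  forall p, p.+1 < n -> (upd u j v p < upd u j v p.+1) = (u p < u p.+1).
Proof.
move=> huv hl hr p hp; rewrite /upd.
case: (eqVneq p j) => [e|e].
  by subst p; case: eqP => [|_]; first lia; move: (hr hp); lia.
by case: eqP => [e'|//]; move: (hl _ e'); rewrite e'; lia.
Qed.

(** The column condition of a ribbon: the first box of row [i] lies above the last box of row
    [i.+1], so the first [i] must precede the last [i.+1]. *)
Definition rows_linked (n r : nat) (u : nat -> nat) : Prop :=
  forall i, i.+1 < r -> exists p q, [/\ p < q, q < n, u p = i & u q = i.+1].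

(* Match each [i], as an opening bracket, with a later [i.+1].  The last argmin [j]
   of [occ u i - occ u i.+1] is the leftmost unmatched [i], and the hypothesis on
   [k] says that more than [k] letters [i] are unmatched; its counterpart in the
   conclusion allows the step to be iterated. *)
Lemma crystal_step (n r : nat) (u : nat -> nat) (i k : nat) :
  (forall p, p < n -> u p < r) -> rows_linked n r u ->
  (forall l, l < r -> 2 <= occ u l n) -> i.+1 < r -> 3 <= occ u i n ->
  (exists2 p, p <= n &
     occ u i p + occ u i.+1 n + k.+1 <= occ u i n + occ u i.+1 p) ->
  exists u' : nat -> nat,
   [/\ forall p, p < n -> u' p < r, rows_linked n r u',
       forall p, p.+1 < n -> (u' p < u' p.+1) = (u p < u p.+1),
       forall l, occ u' l n + (l == i) = occ u l n + (l == i.+1) &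
       exists2 p, p <= n &
         occ u' i p + occ u' i.+1 n + k <= occ u' i n + occ u' i.+1 p].
Proof.
move=> ur lk h2 ir h3 [p0 p0n hk].
have [j jn Hj] := last_argmin (occ u i) (occ u i.+1) n.
have {jn} jn : j < n.
  rewrite ltn_neqAle jn andbT; apply/eqP => e; subst j.
  by have [] := Hj _ p0n; lia.
have uj : u j = i.
  have [_ /(_ (ltnSn j))] := Hj _ jn; rewrite !occS => h.
  by case: (eqVneq (u j) i) h => // _; lia.
(* An [i] just before [j] would contradict minimality, an [i.+1] just after it the choice of the
   last minimiser. So [asc_upd] applies at [j]. *)
have jl p : p.+1 = j -> u p <> i.
  move=> e up; have [] := Hj p; first lia.
  by rewrite -e !occS up eqxx; case: (eqVneq i i.+1); lia.
have jr : j.+1 < n -> u j.+1 <> i.+1.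
  move=> jn1 e; have [_ /(_ _)] := Hj _ jn1.
  by rewrite !occS e uj eqxx; lia.
have range w v : w < n -> v < r -> forall u1 : nat -> nat,
    (forall p, p < n -> u1 p < r) -> forall p, p < n -> upd u1 w v p < r.
  by move=> _ hv u1 hu1 p hp; rewrite /upd; case: ifP => // _; exact: hu1.
(* The link from [i] to [i.+1] survives a change at [j]: if it started at [j], there are more [i]
   than [i.+1] from [j] to [q], hence a second [i] before [q]. *)
have lki : exists p q, [/\ p < q, q < n, u p = i, u q = i.+1 & p <> j].
  have [p [q [pq qn up uq]]] := lk i ir.
  case: (eqVneq p j) => [e|/eqP e]; last by exists p, q.
  subst p; have qj : q <> j.+1 by move=> e; apply: jr; rewrite -e.
  have [_ /(_ _)] := Hj q.+1 qn; rewrite !occS uq eqxx => h.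
  have [s [s1 s2 s3]] : exists p, [/\ j.+1 <= p, p < q & u p = i].
    apply: occ_ltP; rewrite occS uj eqxx.
    by have := @leq_occ u i.+1 j q; move: h; case: (eqVneq i.+1 i) => /=; lia.
  by exists s, q; split=> //; lia.
have occj l : occ (upd u j i.+1) l n + (l == i) = occ u l n + (l == i.+1).
  by have := occ_upd u j i.+1 l n; rewrite jn uj !(eq_sym _ l) !mul1n.
(* If [good] holds, the link from [i.-1] to [i] also survives the change at [j]. *)
pose good := [exists p : 'I_n, exists q : 'I_n,
  [&& p < q, u q == i, (u p).+1 == i & val q != j]].
have lkl l : l.+1 < r -> l.+1 <> i -> exists p q,
    [/\ p < q, q < n, upd u j i.+1 p = l & upd u j i.+1 q = l.+1].
  move=> lr li; case: (eqVneq l i) => [->|/eqP li'].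
    have [p [q [pq qn up uq pj]]] := lki.
    exists p, q; split=> //; first by rewrite upd_neq.
    by rewrite upd_neq // => e; move: uq; rewrite e uj; lia.
  have [p [q [pq qn up uq]]] := lk l lr.
  by exists p, q; split=> //; rewrite upd_neq // => e; subst; lia.
case: (boolP ((i == 0) || good)) => [hgood|].
  exists (upd u j i.+1); split=> //.
  - exact: range.
  - move=> l lr; case: (eqVneq l.+1 i) => [e|/eqP]; last exact: lkl.
    case/orP: hgood => [|/existsP[p /existsP[q /and4P[pq /eqP uq /eqP up qj]]]].
      by rewrite -e.
    exists p, q; split=> //; last by rewrite upd_neq ?uq //; exact/eqP.
    rewrite upd_neq; first lia.
    by move=> e'; move: up; rewrite e' uj; lia.
  - by apply: (asc_upd (i := i)) => //; left.
  (* At [j.+1] the new difference is one below the old minimum, and at [n] it has dropped by two, so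
     the gap shrinks by one. *)
  exists j.+1 => //.
  have := occ_upd u j i.+1 i j.+1; have := occ_upd u j i.+1 i.+1 j.+1.
  have := occj i; have := occj i.+1.
  rewrite !occS ltnSn uj !eqxx.
  have [] := Hj p0 p0n; have [_ /(_ jn)] := Hj n (leqnn n).
  by case: (eqVneq i i.+1); case: (eqVneq i.+1 i) => /=; lia.
(* Otherwise every other occurrence of [i] precedes every occurrence of
   [i.-1], so that [j] is the only unmatched [i].  Let [x] be the occurrence of [i]
   before [j] and [y] the first [i.-1].  If [y = x.+1], the [i] starting the run
   that ends at [x] is changed in place of [j]; if not, the letters at [x] and [y]
   are exchanged as well. *)
rewrite negb_or => /andP[i0 /existsPn nogood].
have {i0} [i' ei] : exists i', i = i'.+1 by exists i.-1; lia.
have bad p q : p < q -> q < n -> u q = i -> u p = i' -> q = j.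
  move=> pq qn uq up; apply/eqP; rewrite -[_ == _]negbK; apply/negP => qj.
  have /existsPn/(_ (Ordinal qn)) := nogood (Ordinal (ltn_trans pq qn)).
  by rewrite /= pq uq up ei !eqxx qj.
have [y [yn /eqP uy yfirst]] : exists y, [/\ y < n, u y == i' & forall p, u p == i' -> y <= p].
  have [p [q [pq qn up _]]] := lk i' ltac:(lia).
  by apply: first_such; exists p; [lia|apply/eqP].
have yj : y < j.
  have [p [q [pq qn up uq]]] := lk i' ltac:(lia).
  rewrite -ei in uq; have := bad _ _ pq qn uq up => <-.
  by apply: leq_ltn_trans pq; apply: yfirst; apply/eqP.
have ibefore q : q < n -> u q = i -> q <> j -> q < y.
  move=> qn uq qj; rewrite ltnNge; apply/negP => yq.
  apply: qj; apply: (bad y) => //.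
  by rewrite ltn_neqAle yq andbT; apply/eqP => e; subst; lia.
have [x [xn /andP[/eqP ux /eqP xj] xlast]] : exists x, [/\ x < n, (u x == i) && (x != j) &
    forall p, p < n -> (u p == i) && (p != j) -> p <= x].
  apply: last_such; have [p [pn up]] := @occ_gt_size u i n [:: j] ltac:(rewrite /=; lia).
  by rewrite inE => pj; exists p => //; rewrite up eqxx.
have xy : x < y by exact: ibefore.
have nlast : occ u i n = (occ u i j).+1.
  apply/eqP; rewrite eqn_leq; apply/andP; split; last first.
    by have := @leq_occ u i j.+1 n jn; rewrite occS uj eqxx; lia.
  rewrite leqNgt; apply/negP => h.
  have [p [h1 h4 h5]] : exists p, [/\ j.+1 <= p, p < n & u p = i].
    by apply: occ_ltP; rewrite occS uj eqxx; lia.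
  by have := ibefore p h4 h5; lia.
have k0 : k = 0.
  have [] := Hj p0 p0n.
  by have := @leq_occ u i.+1 j n; lia.
subst k.
(* The difference at [j] is at most that at [x], so the [i] at [x] must be compensated by an [i.+1]
   before [j]. *)
have [s [sx sj us]] : exists s, [/\ x.+1 <= s, s < j & u s = i.+1].
  apply: occ_ltP; have [] := Hj x (ltnW xn).
  have := @leq_occ u i x.+1 j; rewrite !occS ux eqxx.
  by case: (eqVneq i i.+1) => /=; lia.
(* When [y = x.+1], exchanging the two letters would turn a descent into an ascent. *)
case: (eqVneq y x.+1) => [yx|/eqP yx].
  have [z [zx hz zl]] := run_start u x; rewrite ux in hz zl.
  have uz : u z = i by apply: hz; rewrite leqnn.
  have zn : z < n by lia.
  have occz l : occ (upd u z i.+1) l n + (l == i) = occ u l n + (l == i.+1).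
    by have := occ_upd u z i.+1 l n; rewrite zn uz !(eq_sym _ l) !mul1n.
  exists (upd u z i.+1); split=> //.
  - exact: range.
  - move=> l lr; case: (eqVneq l i) => [->|/eqP li].
      have [p [pn up]] := @occ_gt_size u i n [:: z; j] ltac:(rewrite /=; lia).
      rewrite !inE negb_or => /andP[/eqP pz pj].
      have px : p <= x by apply: xlast => //; rewrite up eqxx.
      by exists p, s; split; [lia|lia|rewrite upd_neq|rewrite upd_neq // => e; subst; lia].
    have [p [q [pq qn up uq]]] := lk l lr.
    case: (eqVneq q z) => [e|/eqP qz].
      by subst q; have := bad p z pq qn uz; rewrite up; lia.
    exists p, q; split=> //; rewrite upd_neq // => e; apply: li; by rewrite -up e.
  - apply: (asc_upd (i := i)) => //; first by left.
    move=> _; case: (eqVneq z x) => [->|/eqP zx']; last by rewrite hz; lia.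
    by rewrite -yx uy; lia.
  by exists n => //; rewrite addn0.
pose u1 := upd u j i.+1; pose u2 := upd u1 x i'; pose u3 := upd u2 y i.
have u1x : u1 x = i by rewrite /u1 upd_neq.
have u2y : u2 y = i' by rewrite /u2 /u1 !upd_neq //; lia.
exists u3; split.
- by apply: (range) => //; [lia|apply: (range) => //; [lia|exact: range]].
- have u3E p : p <> j -> p <> x -> p <> y -> u3 p = u p.
    by move=> *; rewrite /u3 /u2 /u1 !upd_neq.
  have u3y : u3 y = i by rewrite /u3 upd_eq.
  have u3x : u3 x = i' by rewrite /u3 /u2 upd_neq ?upd_eq //; lia.
  have u3j : u3 j = i.+1 by rewrite /u3 /u2 /u1 2?upd_neq ?upd_eq //; lia.
  move=> l lr; case: (eqVneq l i) => [->|/eqP li]; first by exists y, j.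
  case: (eqVneq l i') => [->|/eqP li']; first by exists x, y; rewrite -ei.
  have [p [q [pq qn up uq]]] := lk l lr.
  have hp : u3 p = l by rewrite u3E // => e; subst p; lia.
  case: (eqVneq q y) => [e|/eqP qy].
    (* The letter [i'] occurs at least twice, and its other occurrence comes after the first one,
       [y]. *)
    subst q; have [q' [q'n uq']] := @occ_gt_size u i' n [:: y] ltac:(apply: h2; lia).
    rewrite inE => q'y; have := yfirst q'; rewrite uq' eqxx => /(_ isT) yq'.
    exists p, q'; split=> //; first lia.
    by rewrite u3E; [lia|move=> e'; subst q'; lia..|exact/eqP].
  by exists p, q; split=> //; rewrite u3E // => e; subst q; lia.
- move=> p pn; rewrite /u3 (asc_upd (i := i') _ _ _ pn).
  + rewrite /u2 (asc_upd (i := i') _ _ _ pn).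
    * by rewrite /u1 (asc_upd (i := i) _ _ _ pn) //; left.
    * by right; rewrite u1x.
    * move=> w wx; rewrite /u1 upd_neq; last lia.
      by move=> uw; have := yfirst w; rewrite uw eqxx => /(_ isT); lia.
    move=> xn1; rewrite /u1 /upd -ei; case: eqP => _; first lia.
    by move=> e; have := xlast _ xn1; rewrite e eqxx; case: (eqVneq x.+1 j) => /=; lia.
  + by left; rewrite u2y.
  + move=> w wy; rewrite /u2 /u1 !upd_neq; [|lia..].
    by move=> uw; have := yfirst w; rewrite uw eqxx => /(_ isT); lia.
  move=> yn1; rewrite /u2 /u1 -ei upd_neq; last lia.
  rewrite /upd; case: eqP => [_|e]; first lia.
  by move=> e'; have := ibefore _ yn1 e' e; lia.
- move=> l; have := occj l; rewrite -/u1.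
  have := occ_upd u1 x i' l n; have := occ_upd u2 y i l n.
  by rewrite -/u2 -/u3 u2y u1x xn yn !mul1n; lia.
by exists n => //; rewrite addn0.
Qed.

(** * Moving letters between rows *)

Definition ribbon_word (n : nat) (b : seq nat) (u : nat -> nat) : Prop :=
  [/\ forall p, p < n -> u p < size b,
      forall i, i < size b -> occ u i n = nth 0 b i &
      rows_linked n (size b) u].

Definition asc_realizable (n : nat) (D : nat -> bool) (b : seq nat) : Prop :=
  exists2 u, ribbon_word n b u &
    forall p, p.+1 < n -> (u p < u p.+1) = D p.

(** Iterates [crystal_step]. The numbers of [i] and [i.+1] initially differ by [d], which allows [d]
    steps; the induction records that [d - t] of them remain. *)
Lemma exchange_adjacent n D s1 s2 y d t :
  t <= d -> all (leq 2) (s1 ++ y + d :: y :: s2) ->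
  asc_realizable n D (s1 ++ y + d :: y :: s2) ->
  asc_realizable n D (s1 ++ y + d - t :: y + t :: s2).
Proof.
move=> td h2 [u [ur uo lk] ua]; pose i := size s1.
have szE x z : size (s1 ++ x :: z :: s2) = i.+2 + size s2.
  by rewrite size_cat /= !addnS.
have ne x z l : l <> i -> l <> i.+1 ->
    nth 0 (s1 ++ x :: z :: s2) l = nth 0 (s1 ++ y + d :: y :: s2) l.
  rewrite !nth_cat; case: ltnP => // hl l1 l2.
  by case E: (l - size s1) => [|[|m]] //=; move: l1 l2; rewrite /i; lia.
have ni x z : nth 0 (s1 ++ x :: z :: s2) i = x.
  by rewrite nth_cat ltnn subnn.
have ni1 x z : nth 0 (s1 ++ x :: z :: s2) i.+1 = z.
  by rewrite nth_cat ltnNge leqnSn subSnn.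
have := all_nthP 0 h2; rewrite szE => {}h2.
have y2 : 2 <= y by rewrite -(ni1 (y + d) y); apply: h2; lia.
suff [v [vr vlk va vo _]] : exists v : nat -> nat,
   [/\ forall p, p < n -> v p < i.+2 + size s2, rows_linked n (i.+2 + size s2) v,
       forall p, p.+1 < n -> (v p < v p.+1) = D p,
       forall l, l < i.+2 + size s2 ->
         occ v l n = nth 0 (s1 ++ y + d - t :: y + t :: s2) l &
       exists2 p, p <= n &
         occ v i p + occ v i.+1 n + (d - t) <= occ v i n + occ v i.+1 p].
  by exists v; [rewrite /ribbon_word szE|].
rewrite szE in ur uo lk.
elim: t td => [|t IH] td.
  exists u; rewrite subn0 addn0; split=> //.
  by exists 0 => //; rewrite !occ0 !uo ?ni ?ni1; lia.
have [v [vr vlk va vo [p pn vp]]] := IH (ltnW td).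
have vi : occ v i n = y + d - t by rewrite vo ?ni //; lia.
have vi1 : occ v i.+1 n = y + t by rewrite vo ?ni1 //; lia.
have v2 l : l < i.+2 + size s2 -> 2 <= occ v l n.
  move=> hl; case: (eqVneq l i) => [->|/eqP l1]; first lia.
  case: (eqVneq l i.+1) => [->|/eqP l2]; first lia.
  by rewrite vo // ne //; apply: h2.
have [|||w [wr wlk wa wo hw]] := crystal_step (k := d - t.+1) vr vlk v2 (i := i).
- lia.
- lia.
- exists p => //; lia.
exists w; split=> //.
- by move=> q qn; rewrite wa ?va.
move=> l hl; have := wo l.
case: (eqVneq l i) => [->|/eqP l1]; first by rewrite ni; case: (eqVneq i i.+1); lia.
case: (eqVneq l i.+1) => [->|/eqP l2]; first by rewrite ni1; lia.
by rewrite !addn0 => ->; rewrite vo // ne // ne.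
Qed.

Lemma occ_mirror n r u i : (forall p, p < n -> u p < r) -> i < r ->
  occ (fun p => r - (u (n - p.+1)).+1) i n = occ u (r - i.+1) n.
Proof.
move=> ur ir; rewrite /occ (reindex_inj rev_ord_inj) /=.
apply: eq_bigr => p _; have pn := ltn_ord p.
have -> : n - (n - p.+1).+1 = p by lia.
by have := ur p pn; lia.
Qed.

(** Reversing the word and complementing its letters keeps the ascents, at reflected positions.
    Moves available when a part exceeds the next one thus become available in the opposite order. *)
Lemma asc_realizable_mirror n D b :
  asc_realizable n D b -> asc_realizable n (fun p => D (n - p.+2)) (rev b).
Proof.
move=> [u [ur uo lk] ua]; exists (fun p => size b - (u (n - p.+1)).+1); first split.
- by move=> p pn; rewrite size_rev; have := ur (n - p.+1); lia.
- by move=> i; rewrite size_rev => ib; rewrite occ_mirror // uo ?nth_rev //; lia.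
- move=> i; rewrite size_rev => ib; have [|p [q [pq qn up uq]]] := lk (size b - i.+2).
    lia.
  exists (n - q.+1), (n - p.+1); split; [lia|lia| |].
    by rewrite (_ : n - (n - q.+1).+1 = q); lia.
  by rewrite (_ : n - (n - p.+1).+1 = p); lia.
move=> p pn; rewrite -ua; last lia.
have -> : (n - p.+2).+1 = n - p.+1 by lia.
by have := ur (n - p.+1); have := ur (n - p.+2); lia.
Qed.

Lemma eq_asc_realizable n D D' b : (forall p, p.+1 < n -> D p = D' p) ->
  asc_realizable n D b -> asc_realizable n D' b.
Proof. by move=> e [u h1 h2]; exists u => // p pn; rewrite h2 // e. Qed.

(** For [y <= x] this is [exchange_adjacent] with [t = d]; the other case is its mirror image. *)
Lemma swap_adjacent n D s1 s2 x y : all (leq 2) (s1 ++ x :: y :: s2) ->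
  asc_realizable n D (s1 ++ x :: y :: s2) -> asc_realizable n D (s1 ++ y :: x :: s2).
Proof.
have down D' t1 t2 a b : b <= a -> all (leq 2) (t1 ++ a :: b :: t2) ->
    asc_realizable n D' (t1 ++ a :: b :: t2) -> asc_realizable n D' (t1 ++ b :: a :: t2).
  move=> ba; rewrite -(subnKC ba) => h2 /(exchange_adjacent (leqnn _) h2).
  by rewrite addnK.
case: (leqP y x) => [|xy h2 h]; first exact: down.
have revE a b : rev (s1 ++ a :: b :: s2) = rev s2 ++ b :: a :: rev s1.
  by rewrite rev_cat !rev_cons -!cats1 -!catA.
have := asc_realizable_mirror h; rewrite revE => /down -/(_ (ltnW xy)).
rewrite -revE all_rev => /(_ h2) /asc_realizable_mirror.
rewrite -revE revK; apply: eq_asc_realizable => p pn.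
by congr (D _); lia.
Qed.

Lemma perm_asc_realizable n D s t : all (leq 2) s -> perm_eq s t ->
  asc_realizable n D s -> asc_realizable n D t.
Proof.
(* [pre] holds the parts already in place; the head of [t] is brought next to them by adjacent
   swaps. *)
suff gen pre : all (leq 2) (pre ++ s) -> perm_eq s t ->
    asc_realizable n D (pre ++ s) -> asc_realizable n D (pre ++ t).
  exact: (gen [::]).
elim: t s pre => [|x t IH] s pre h2 st; first by rewrite (perm_nilP st).
have xs : x \in s by rewrite (perm_mem st) mem_head.
case/splitPr: xs h2 st => s1 s2 h2 st h.
have {st} st : perm_eq (s1 ++ s2) t.
  by rewrite -(perm_cons x) (perm_trans _ st) // perm_sym perm_catC /= perm_cons perm_catC.
rewrite -cat_rcons; apply: (IH (s1 ++ s2)) => //.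
  by move: h2; rewrite -cats1 !all_cat /= andbT => /and4P[-> -> -> ->].
elim/last_ind: s1 s2 h2 h {st} => [|s1 y IHs] s2 h2 h; first by rewrite cat_rcons.
have {}h : asc_realizable n D (pre ++ s1 ++ x :: y :: s2).
  by move: h2 h; rewrite cat_rcons !catA; apply: swap_adjacent.
rewrite (cat_rcons y); apply: IHs => //.
by move: h2; rewrite cat_rcons !all_cat /= => /and5P[-> -> -> -> ->].
Qed.

(** * Descent in the dominance order *)

Definition psum (s : seq nat) k := sumn (take k s).

Lemma psumS s k : psum s k.+1 = psum s k + nth 0 s k.
Proof.
rewrite /psum; case: (ltnP k (size s)) => h.
  by rewrite (take_nth 0) // sumn_rcons.
by rewrite !take_oversize ?nth_default ?addn0 //; lia.
Qed.

(** At the first difference [p], the part of [a] is the smaller one. If [b] never fell where there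
    is slack, it would not decrease from [p] on, while [a] is weakly decreasing; the slack would
    persist to the end, against the equal sums. *)
Lemma slack_descent a b : sorted geq a -> size a = size b -> sumn a = sumn b ->
  (forall k, psum a k <= psum b k) -> a <> b ->
  exists k, [/\ k.+1 < size b, psum a k.+1 < psum b k.+1 & nth 0 b k.+1 < nth 0 b k].
Proof.
move=> sa sz sm dom ab.
have ex : exists k, (k < size b) && (nth 0 a k != nth 0 b k).
  case: (boolP (has (fun k => nth 0 a k != nth 0 b k) (iota 0 (size b)))).
    by move=> /hasP[k]; rewrite mem_iota => /= h1 h2; exists k; rewrite h1.
  move=> /hasPn h; case: ab; apply: (@eq_from_nth _ 0) => // k kb.
  by apply/eqP; rewrite -[_ == _]negbK; apply: h; rewrite mem_iota -sz.
case: (ex_minnP ex) => p /andP[pb hp] pmin.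
have eqp k : k <= p -> psum a k = psum b k.
  elim: k => [|k IH] kp; first by rewrite /psum !take0.
  rewrite !psumS IH; last exact: ltnW.
  congr (_ + _); apply/eqP; rewrite -[_ == _]negbK; apply/negP => h.
  by have := pmin k; rewrite h andbT => /(_ (ltn_trans kp pb)); lia.
have ap : nth 0 a p < nth 0 b p.
  by have := dom p.+1; rewrite !psumS eqp //; lia.
have sa' k : k.+1 < size b -> nth 0 a k.+1 <= nth 0 a k.
  by move=> hk; apply: (sortedP 0 sa); rewrite sz.
case: (boolP (has (fun k => (psum a k.+1 < psum b k.+1) && (nth 0 b k.+1 < nth 0 b k))
         (iota 0 (size b).-1))).
  by move=> /hasP[k]; rewrite mem_iota => /= h1 /andP[h2 h3]; exists k; split=> //; lia.
move=> /hasPn no.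
have slack m : p + m < size b ->
    nth 0 a (p + m) < nth 0 b (p + m) /\ psum a (p + m).+1 < psum b (p + m).+1.
  elim: m => [|m IH] hm; first by rewrite addn0 !psumS eqp //; split=> //; lia.
  have [h1 h2'] := IH ltac:(lia).
  have := no (p + m); rewrite mem_iota h2' /= -leqNgt => h3.
  have h4 := sa' (p + m) ltac:(lia).
  rewrite !addnS !(psumS _ (p + m).+1); move: (h3 ltac:(lia)); lia.
have [_] := slack ((size b).-1 - p) ltac:(lia).
have -> : (p + ((size b).-1 - p)).+1 = size b by lia.
by rewrite /psum !take_oversize ?sz // sm ltnn.
Qed.

(** Moving one unit from part [k] to part [k.+1], at a descent with slack, lowers only the partial
    sum at [k.+1], by one. The induction is on the total of the partial sums; the intermediate
    sequences may be unsorted. *)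
Lemma dominance_asc_realizable n D a b : sorted geq a -> size a = size b ->
  sumn a = sumn b -> (forall k, psum a k <= psum b k) -> all (leq 2) b ->
  asc_realizable n D b -> asc_realizable n D a.
Proof.
move=> sa.
have [m] := ubnP (\sum_(k < size b) psum b k); elim: m b => // m IH b hm sz sm dom b2 h.
case: (eqVneq a b) => [->//|/eqP ab].
have [k [kb slack desc]] := slack_descent sa sz sm dom ab.
pose x := nth 0 b k; pose y := nth 0 b k.+1.
have bE : b = take k b ++ x :: y :: drop k.+2 b.
  by rewrite -!drop_nth ?cat_take_drop //; lia.
have szk : size (take k b) = k by rewrite size_takel //; lia.
pose b' := take k b ++ x.-1 :: y.+1 :: drop k.+2 b.
have sz' : size b' = size b by rewrite [in RHS]bE !size_cat.
have nthb' i : nth 0 b' i = if i == k then x.-1 else if i == k.+1 then y.+1 else nth 0 b i.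
  rewrite [in nth 0 b i]bE !nth_cat szk; case: (ltngtP i k) => [ik|ik|->].
  - by case: eqP => // ?; lia.
  - case: (i - k) (subnK (ltnW ik)) => [|[|j]] e; [lia|by case: eqP => //; lia|].
    by case: eqP => //; lia.
  by rewrite subnn.
have psum' i : psum b' i + (i == k.+1) = psum b i.
  elim: i => [|i IHi]; first by rewrite /psum !take0.
  move: IHi; rewrite !psumS nthb' eqSS.
  case: (eqVneq i k) => [->|ik]; first by rewrite -/x; case: eqP; lia.
  by case: (eqVneq i k.+1) => [->|]; rewrite -/y /=; lia.
have sum' : sumn b' = sumn b.
  have := psum' (size b); rewrite /psum take_size take_oversize ?sz' //.
  by case: eqP => //; lia.
apply: (IH b') => //.
- rewrite -ltnS; apply: leq_trans hm; rewrite ltnS sz'.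
  have <- : \sum_(i < size b) (psum b' i + (val i == k.+1)) = \sum_(i < size b) psum b i.
    by apply: eq_bigr => i _; exact: psum'.
  rewrite big_split /= -[X in X < _]addn0 ltn_add2l (bigD1 (Ordinal kb)) //= eqxx.
  by rewrite addSn.
- by rewrite sz'.
- by rewrite sum'.
- move=> i; have := dom i; rewrite -(psum' i).
  case: (eqVneq i k.+1) => [->|]; last by rewrite addn0.
  by move: slack; rewrite -psum' eqxx; lia.
(* Part [k] stays at least 2 because it exceeded [y], which is at least 2. *)
- have xy : y < x by [].
  move: b2; rewrite {1}bE /b' !all_cat /= => /andP[-> /and3P[hx hy ->]].
  by rewrite andbT /=; apply/andP; split; lia.
have [d ed] : exists d, x = y + d by exists (x - y); lia.
have := @exchange_adjacent n D (take k b) (drop k.+2 b) y d 1.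
rewrite -ed -bE addn1 subn1; apply=> //; lia.
Qed.

(** * Extremal words *)

Lemma sumn_map_nth (f : nat -> nat) s :
  sumn (map f s) = \sum_(i < size s) f (nth 0 s i).
Proof. by rewrite sumnE big_map (big_nth 0) big_mkord. Qed.

Lemma sumn_nth s : sumn s = \sum_(i < size s) nth 0 s i.
Proof. by rewrite -(sumn_map_nth id) map_id. Qed.

Lemma sum_occ u n r m : (forall p, p < n -> u p < r) -> m <= n ->
  \sum_(i < r) occ u i m = m.
Proof.
move=> ur; elim: m => [|m IH] mn.
  by rewrite big1 // => i _; rewrite occ0.
under eq_bigr => i _ do rewrite occS.
rewrite big_split /= IH; last exact: ltnW.
rewrite (bigD1 (Ordinal (ur m mn))) //= eqxx big1 ?addn0 ?addn1 // => i.
by rewrite -val_eqE /= eq_sym => /negbTE->.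
Qed.

Lemma ribbon_word_nth b v : all (gtn (size b)) v ->
  (forall i, i < size b -> count_mem i v = nth 0 b i) ->
  (forall i, i.+1 < size b -> exists p q,
     [/\ p < q, q < size v, nth 0 v p = i & nth 0 v q = i.+1]) ->
  ribbon_word (size v) b (nth 0 v).
Proof.
move=> /(all_nthP 0) vb vo lk; split=> // i ib.
by rewrite occ_count mkseq_nth vo.
Qed.

Lemma psum_le s k : psum s k <= sumn s.
Proof. by rewrite -[in X in _ <= X](cat_take_drop k s) sumn_cat leq_addr. Qed.

(* [\sum_x (x - k)] is the maximum over [m] of [psum s m - m * k], attained
   for sorted [s] when the [m]-th part is close to [k]. *)
Lemma dominance_of_conjugate a b : sorted geq b -> sumn a = sumn b ->
  (forall k, k <= sumn b -> sumn (map (minn k) b) <= sumn (map (minn k) a)) ->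
  forall m, psum a m <= psum b m.
Proof.
move=> sb ab conj m; case: (leqP (size b) m) => hm.
  by rewrite [psum b m]/psum take_oversize // -ab psum_le.
(* For this [k] the first [m] parts of [b] are at least [k] and the others at most [k], so [b]
   attains the bound [up] at [m]. *)
pose k := nth 0 b m; pose ex s := sumn (map (subn^~ k) s).
have split s : sumn s = sumn (map (minn k) s) + ex s.
  by rewrite /ex; elim: s => //= x s ->; rewrite /minn; case: ltnP; lia.
have kb : k <= sumn b by rewrite (leq_trans _ (psum_le b m.+1)) // psumS leq_addl.
have exab : ex a <= ex b by have := split a; have := split b; have := conj k kb; lia.
have up s i : psum s i <= ex s + k * i.
  rewrite /psum /ex; elim: s i => [|x s IH] [|i] //=.
  by have := IH i; rewrite mulnS; lia.
apply: leq_trans (up a m) _; apply: (@leq_trans (ex b + k * m)); first lia.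
have geq_nth i j : i <= j -> j < size b -> nth 0 b j <= nth 0 b i.
  move=> ij jb; apply: (sorted_leq_nth (leT := geq)) => //.
  - by move=> x y z /= h1 h2; apply: leq_trans h2 h1.
  - by move=> x /=.
  by rewrite inE (leq_ltn_trans ij).
have -> : ex b = sumn (map (subn^~ k) (take m b)).
  rewrite /ex -[in LHS](cat_take_drop m b) map_cat sumn_cat.
  rewrite [X in _ + X](_ : _ = 0) ?addn0 //.
  apply/eqP; rewrite sumn_map_nth sum_nat_eq0; apply/forallP => i; apply/implyP => _.
  rewrite nth_drop subn_eq0 geq_nth ?leq_addr //.
  by move: (valP i); rewrite /= [X in _ < X]size_drop; lia.
have : all (leq k) (take m b).
  apply/(all_nthP 0) => i; rewrite size_takel ?(ltnW hm) // => im.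
  by rewrite nth_take // geq_nth // ltnW.
have -> : k * m = k * size (take m b) by rewrite size_takel // ltnW.
rewrite /psum; elim: (take m b) => [|x s IH /= /andP[xk /IH]]; first by rewrite muln0.
by rewrite mulnS; lia.
Qed.

Lemma occ_increasing (u : nat -> nat) i m n :
  (forall p, m <= p -> p.+1 < n -> u p < u p.+1) -> occ u i n <= (occ u i m).+1.
Proof.
move=> inc; case: (leqP n m) => [nm|].
  by have := @leq_occ u i n m nm; lia.
(* In the increasing stretch [i] can have been met only if the current letter has reached [i]. *)
suff H d : m + d < n -> occ u i (m + d).+1 <= occ u i m + (i <= u (m + d)).
  by move=> mn; have := H (n.-1 - m); rewrite (_ : (m + (n.-1 - m)).+1 = n); lia.
elim: d => [|d IH] dn; first by rewrite addn0 occS; lia.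
have := inc (m + d) ltac:(lia) ltac:(lia); have := IH ltac:(lia).
by rewrite addnS (occS _ _ (m + d).+1); lia.
Qed.

Lemma occ_flatten_increasing (ss : seq (seq nat)) u i : all (sorted ltn) ss ->
  (forall p, p.+1 < size (flatten ss) ->
     nth 0 (flatten ss) p < nth 0 (flatten ss) p.+1 -> u p < u p.+1) ->
  occ u i (size (flatten ss)) <= size ss.
Proof.
elim/last_ind: ss => [|ss s IH]; first by rewrite occ0.
rewrite all_rcons flatten_rcons size_cat size_rcons => /andP[ss1 ss2] inc.
apply: (@leq_trans (occ u i (size (flatten ss))).+1).
  apply: occ_increasing => p p1 p2; apply: inc => //.
  rewrite !nth_cat [p < _]ltnNge [p.+1 < _]ltnNge p1 leqW //= subSn //.
  by apply: (sortedP 0 ss1); lia.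
rewrite ltnS; apply: IH => // p p1 p2; apply: inc; first lia.
by rewrite !nth_cat p1 (ltn_trans _ p1).
Qed.

(** The run lengths are the first [k] parts of the conjugate of [b]. *)
Definition row_runs (b : seq nat) k :=
  [seq [seq i <- iota 0 (size b) | j < nth 0 b i] | j <- iota 0 k].

Lemma sum_ltn_minn k x : \sum_(j < k) (j < x) = minn k x.
Proof.
elim: k => [|k IH]; first by rewrite big_ord0 min0n.
by rewrite big_ord_recr /= IH; lia.
Qed.

Lemma size_row_runs b k : size (flatten (row_runs b k)) = sumn (map (minn k) b).
Proof.
rewrite size_flatten /shape -map_comp sumn_map_nth size_iota sumn_map_nth.
under [RHS]eq_bigr => i _ do rewrite -sum_ltn_minn.
rewrite exchange_big; apply: eq_bigr => j _; rewrite nth_iota //= size_filter.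
rewrite -sum1_count big_mkcond /= -[in iota 0 _](subn0 (size b)) big_mkord.
by apply: eq_bigr => i _; case: ifP.
Qed.

Lemma count_row_runs b k i : i < size b ->
  count_mem i (flatten (row_runs b k)) = minn k (nth 0 b i).
Proof.
move=> ib; rewrite count_flatten -map_comp sumn_map_nth size_iota -sum_ltn_minn.
apply: eq_bigr => j _; rewrite nth_iota //= count_uniq_mem ?filter_uniq ?iota_uniq //.
by rewrite mem_filter mem_iota add0n ib leq0n !andbT.
Qed.

(** Let the first [k] runs of [v] fill [m] positions. A word [u] with the same ascents increases
    along each run, so it has at most [minn k (nth 0 a i)] letters [i] there. The letters at these
    positions number [m] in all, which bounds [m] by the sum for [a]. *)
Lemma exists_column_word b : all (leq 2) b ->
  exists2 v, ribbon_word (sumn b) b v &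
    forall a u, ribbon_word (sumn b) a u ->
      (forall p, p.+1 < sumn b -> (u p < u p.+1) = (v p < v p.+1)) ->
      forall k, k <= sumn b -> sumn (map (minn k) b) <= sumn (map (minn k) a).
Proof.
move=> b2; set n := sumn b; have /(all_nthP 0) {}b2 := b2.
have bn i : nth 0 b i <= n by rewrite (leq_trans _ (psum_le b i.+1)) // psumS leq_addl.
pose v := flatten (row_runs b n).
have sv : size v = n.
  rewrite size_row_runs sumn_map_nth -[RHS]/(sumn b) sumn_nth; apply: eq_bigr => i _.
  exact/minn_idPr.
exists (nth 0 v).
  rewrite -sv; apply: ribbon_word_nth.
  - apply/allP => x /flattenP[s /mapP[j _ ->]].
    by rewrite mem_filter mem_iota => /andP[_].
  - by move=> i ib; rewrite count_row_runs //; exact/minn_idPr.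
  move=> i ib; have n2 : 1 < n by exact: leq_trans (b2 i (ltnW ib)) (bn i).
  (* All parts are positive, so the first run is the whole alphabet and provides every link. *)
  have vE : v = iota 0 (size b) ++ flatten (map (fun j =>
      [seq i <- iota 0 (size b) | j < nth 0 b i]) (iota 1 n.-1)).
    have e : iota 0 n = 0 :: iota 1 n.-1 by rewrite -{1}(prednK (ltnW n2)).
    rewrite /v /row_runs e /=.
    congr (_ ++ _); apply/all_filterP/allP => x; rewrite mem_iota /= add0n => xb.
    exact: leq_trans (b2 x xb).
  exists i, i.+1; split=> //.
  - by rewrite vE size_cat size_iota (leq_trans ib) // leq_addr.
  - by rewrite vE nth_cat size_iota (ltnW ib) nth_iota // ltnW.
  by rewrite vE nth_cat size_iota ib nth_iota.
move=> a u [ur uo _] uv k kn; rewrite -size_row_runs.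
have vcat : v = flatten (row_runs b k) ++ drop (size (flatten (row_runs b k))) v.
  rewrite /v /row_runs -[in iota 0 n](subnKC kn) iotaD map_cat flatten_cat.
  by rewrite drop_size_cat.
set m := size _ in vcat *.
have mn : m <= n by rewrite -sv vcat size_cat leq_addr.
rewrite -[m](sum_occ ur mn) sumn_map_nth; apply: leq_sum => i _.
rewrite leq_min -uo // leq_occ // andbT.
have <- : size (row_runs b k) = k by rewrite size_map size_iota.
apply: occ_flatten_increasing.
  apply/allP => s /mapP[j _ ->]; apply: sorted_filter; last exact: iota_ltn_sorted.
  exact: ltn_trans.
move=> p pm lt; rewrite uv; last by apply: leq_trans mn.
by rewrite vcat !nth_cat pm (ltnW pm).
Qed.

(** In a word with the same ascents the letters over [w] weakly decrease, so the later letter of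
    each link lies in the last [r.-1] positions. These must carry all nonzero letters below
    [size a]. *)
Lemma exists_flat_word b : all (leq 2) b ->
  exists2 v, ribbon_word (sumn b) b v &
    forall a u, ribbon_word (sumn b) a u -> 
      (forall p, p.+1 < sumn b -> (u p < u p.+1) = (v p < v p.+1)) ->
      0 < size b -> size a <= size b.
Proof.
move=> b2; set n := sumn b; have /(all_nthP 0) {}b2 := b2; set r := size b in b2 *.
(* One copy of each nonzero letter is kept back for the final block. *)
pose w := sort geq (flatten [seq nseq (nth 0 b i - (0 < i)) i | i <- iota 0 r]).
pose v := w ++ rev (iota 1 r.-1).
have cw i : i < r -> count_mem i w = nth 0 b i - (0 < i).
  move=> ir; rewrite (permP (permEl (perm_sort _ _))) count_flatten -map_comp.
  rewrite sumn_map_nth size_iota (bigD1 (Ordinal ir)) //= nth_iota // count_nseq /= eqxx mul1n.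
  rewrite big1 ?addn0 // => j /eqP ji; rewrite nth_iota //= count_nseq /=.
  by case: eqP => // e; case: ji; apply: val_inj.
have cv i : i < r -> count_mem i v = nth 0 b i.
  move=> ir; rewrite count_cat cw // count_rev count_uniq_mem ?iota_uniq // mem_iota.
  by have := b2 i ir; rewrite (_ : 1 + r.-1 = r); lia.
have vr : all (gtn r) v.
  rewrite all_cat all_rev; apply/andP; split; apply/allP => x.
    rewrite mem_sort => /flattenP[s /mapP[j]]; rewrite mem_iota /= => jr -> .
    by rewrite mem_nseq => /andP[_ /eqP->].
  by rewrite mem_iota /=; lia.
have sv : size v = n.
  rewrite -[RHS]/(sumn b) sumn_nth -/r -[LHS](@sum_occ (nth 0 v) (size v) r _ _ (leqnn _)).
    by apply: eq_bigr => i _; rewrite occ_count mkseq_nth cv.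
  by move/(all_nthP 0): vr.
exists (nth 0 v).
  rewrite -sv; apply: ribbon_word_nth => // i ib.
  have iw : i \in w.
    by rewrite -has_pred1 has_count cw ?(ltnW ib) //; have := b2 i (ltnW ib); lia.
  have ir : i.+1 \in rev (iota 1 r.-1) by rewrite mem_rev mem_iota; rewrite -/r in ib; lia.
  exists (index i w), (size w + index i.+1 (rev (iota 1 r.-1))).
  split.
  - by rewrite ltn_addr // index_mem.
  - by rewrite /v size_cat ltn_add2l index_mem.
  - by rewrite /v nth_cat index_mem iw nth_index.
  by rewrite /v nth_cat ltnNge leq_addr addKn nth_index.
move=> a u [ur uo lk] uv r0.
have szw : size w + r.-1 = n by rewrite -sv size_cat size_rev size_iota.
have ws : sorted geq w by apply: sort_sorted => x y; rewrite /= leq_total.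
have udec p q : p <= q -> q < size w -> u q <= u p.
  move=> /subnKC <-; elim: (q - p) => [|d IH] dw; first by rewrite addn0.
  apply: leq_trans (IH _); last by lia.
  rewrite addnS leqNgt uv; last lia.
  rewrite !nth_cat (_ : p + d < size w); last lia.
  rewrite (_ : (p + d).+1 < size w); last lia.
  by rewrite -leqNgt; apply: (sortedP 0 ws); lia.
suff : size (iota 1 (size a).-1) <= size [seq u q | q <- iota (size w) r.-1].
  by rewrite size_map !size_iota; lia.
apply: uniq_leq_size (iota_uniq _ _) _ => -[|i]; rewrite mem_iota //= => ia.
have [|p [q [pq qn up uq]]] := lk i; first lia.
apply/mapP; exists q => //; rewrite mem_iota szw qn andbT leqNgt; apply/negP => qw.
by have := udec p q (ltnW pq) qw; lia.
Qed.

Lemma asc_realizable_sub a b : all (leq 2) a -> all (leq 2) b -> sumn a = sumn b ->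
  (forall D, asc_realizable (sumn b) D b -> asc_realizable (sumn b) D a) <->
  size a <= size b /\ (forall m, psum (sort geq a) m <= psum (sort geq b) m).
Proof.
move=> a2 b2 ab.
have sortp s : perm_eq s (sort geq s) by rewrite perm_sym perm_sort.
have sumn_sort s : sumn (sort geq s) = sumn s by rewrite (perm_sumn (sortp s)).
have sort_sort s : sorted geq (sort geq s) by apply: sort_sorted => x y /=; rewrite leq_total.
split=> [sub|[sab dom] D].
  split.
    have [v vb hv] := exists_flat_word b2.
    have [|u ua uv] := sub (fun p => v p < v p.+1); first by exists v.
    case: (posnP (size b)) => [/size0nil eb|]; last exact: hv ua uv.
    by move: ab a2; rewrite eb; case: a {sub ua} => //= x a; lia.
  have [v vb hv] := exists_column_word b2.
  have [|u ua uv] := sub (fun p => v p < v p.+1); first by exists v.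
  apply: dominance_of_conjugate; rewrite ?sumn_sort // => k kb.
  rewrite !(perm_sumn (perm_map _ (permEl (perm_sort _ _)))); exact: hv ua uv k kb.
(* If [b] had more parts than [a], its [size a] largest parts would sum to less than [sumn b], which
   is [sumn a], against [dom]. *)
have sba : size b <= size a.
  rewrite leqNgt; apply/negP => lt; have := dom (size a).
  rewrite /psum [take _ (sort geq a)]take_oversize ?size_sort //.
  have e := cat_take_drop (size a) (sort geq b).
  rewrite sumn_sort ab -(sumn_sort b) -[X in sumn X <= _]e sumn_cat.
  have : all (leq 2) (drop (size a) (sort geq b)).
    have : all (leq 2) (sort geq b) by rewrite all_sort.
    by rewrite -{1}e all_cat => /andP[].
  have : 0 < size (drop (size a) (sort geq b)) by rewrite size_drop size_sort; lia.
  by case: (drop _ _) => //= x s _ /andP[]; lia.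
move=> /(perm_asc_realizable b2 (sortp b)) h.
apply: (@perm_asc_realizable _ _ (sort geq a)); rewrite ?all_sort ?perm_sort //.
apply: dominance_asc_realizable h; rewrite ?size_sort ?sumn_sort ?all_sort //.
by apply/eqP; rewrite eqn_leq sab sba.
Qed.

(** * Compositions and the fundamental basis *)

(** A form of [comp_of_set] for predicates on [nat], free of types depending on the size; position
    [p] stands for the integer [p.+1]. *)
Definition pred_comp (n : nat) (D : nat -> bool) : seq nat :=
  if n == 0 then [::] else
  pairmap (fun x y => y - x) 0 (rcons [seq p.+1 | p <- iota 0 n.-1 & D p] n).

Lemma comp_of_setE n (S : {set 'I_n.-1}) (D : nat -> bool) :
  (forall i : 'I_n.-1, (i \in S) = D i) -> comp_of_set S = pred_comp n D.
Proof.
move=> SD; rewrite /comp_of_set /pred_comp; case: ifP => // _.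
congr (pairmap _ _ (rcons _ _)).
rewrite -val_enum_ord filter_map -map_comp enumT /enum_mem.
by congr (map _ _); apply: eq_filter => i /=; rewrite SD.
Qed.

Lemma scanl_pairmap x s : path leq x s ->
  scanl addn x (pairmap (fun x y => y - x) x s) = s.
Proof. by elim: s x => //= y s IH x /andP[xy /IH]; rewrite subnKC // => ->. Qed.

Lemma path_positions n (D : nat -> bool) : 0 < n ->
  path ltn 0 (rcons [seq p.+1 | p <- iota 0 n.-1 & D p] n).
Proof.
move=> n0; rewrite rcons_path; apply/andP; split.
  rewrite path_min_sorted ?all_map; last by apply/allP.
  rewrite sorted_map; apply: (@sub_sorted _ ltn) => //.
  by apply: sorted_filter; [exact: ltn_trans|exact: iota_ltn_sorted].
have := mem_last 0 [seq p.+1 | p <- iota 0 n.-1 & D p]; rewrite inE => /orP[/eqP->//|].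
by case/mapP => p; rewrite mem_filter mem_iota => /andP[_] h ->; lia.
Qed.

Lemma pred_comp_inj n D D' : pred_comp n D = pred_comp n D' ->
  forall p, p.+1 < n -> D p = D' p.
Proof.
rewrite /pred_comp; case: eqP => [->//|/eqP n0].
have {}n0 : 0 < n by lia.
have le E : path leq 0 (rcons [seq p.+1 | p <- iota 0 n.-1 & E p] n).
  by apply: sub_path (path_positions _ n0) => x y /ltnW.
move=> /(congr1 (scanl addn 0)); rewrite !scanl_pairmap // => /rcons_inj[e] p pn.
have {}e := inj_map succn_inj e.
have := congr1 (fun s => p \in s) e; rewrite /= !mem_filter mem_iota.
have -> : 0 <= p < 0 + n.-1 by lia.
by rewrite !andbT.
Qed.

Lemma is_comp_pred_comp n D : is_comp (pred_comp n D).
Proof.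
rewrite /is_comp /pred_comp; case: eqP => // /eqP; rewrite -lt0n => n0.
suff H x s : path ltn x s -> 0 \notin pairmap (fun x y => y - x) x s.
  exact: H (path_positions D n0).
elim: s x => //= y s IH x /andP[xy /IH].
by rewrite inE negb_or => ->; rewrite andbT eq_sym -lt0n subn_gt0.
Qed.

Lemma size_comp_of_set n (S : {set 'I_n.-1}) : 0 < n ->
  size (comp_of_set S) = #|S|.+1.
Proof.
move=> n0; rewrite /comp_of_set (negbTE (lt0n_neq0 n0)).
by rewrite size_pairmap size_rcons size_map -cardE.
Qed.

Lemma scanl_addn_ltn x a : is_comp a -> path ltn x (scanl addn x a).
Proof.
elim: a x => //= y a IH x; rewrite /is_comp inE negb_or => /andP[y0 /IH ->].
by rewrite andbT; lia.
Qed.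

Lemma last_scanl_addn x a : last x (scanl addn x a) = x + sumn a.
Proof. by elim: a x => [|y a IH] x /=; rewrite ?addn0 // IH addnA. Qed.

(** Both sides are successive differences of strictly increasing lists, so it suffices that these
    lists have the same members. *)
Lemma set_of_compK a : is_comp a -> comp_of_set (set_of_comp (sumn a) a) = a.
Proof.
move=> ca; rewrite (comp_of_setE (D := fun p => p.+1 \in scanl addn 0 a)); last first.
  by move=> i; rewrite inE.
rewrite /pred_comp; case: eqP => [n0|/eqP n0].
  by case: a ca n0 => [|y a] //; rewrite /is_comp inE negb_or /= => /andP[]; lia.
rewrite -[RHS](scanlK (f := fun x y => y - x) addKn 0); congr (pairmap _ _ _).
have incr := scanl_addn_ltn 0 ca; have lst := last_scanl_addn 0 a; rewrite add0n in lst.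
have lt0 : 0 < sumn a by lia.
apply: (@irr_sorted_eq _ ltn) => [||||x].
- exact: ltn_trans.
- exact: ltnn.
- exact: path_sorted (path_positions _ lt0).
- exact: path_sorted incr.
rewrite mem_rcons inE; case: (eqVneq x (sumn a)) => [->|xn] /=.
  rewrite -lst; have := mem_last 0 (scanl addn 0 a); rewrite inE => /orP[/eqP e|->//].
  by rewrite e in lst; lia.
have xin : x \in scanl addn 0 a -> 0 < x < sumn a.
  move=> hx; have -> /= : 0 < x.
    by move: incr; rewrite (path_sortedE ltn_trans) => /andP[/allP/(_ x hx)].
  rewrite ltn_neqAle xn -lst /=; case/splitPr: hx incr => s1 s2.
  rewrite cat_path last_cat /= => /and3P[_ _ h].
  have := mem_last x s2; rewrite inE => /orP[/eqP->//|h'].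
  by move: h; rewrite (path_sortedE ltn_trans) => /andP[/allP/(_ _ h')/ltnW].
apply/mapP/idP => [[p]|hx]; first by rewrite mem_filter => /andP[h _] ->.
have := xin hx; case: x hx {xn xin} => // p hp hp'; exists p => //.
by rewrite mem_filter hp mem_iota; lia.
Qed.

(** For a composition [a], this monomial occurs in [Mqsym a] and in no other [Mqsym b], so
    evaluating a series at it extracts the coefficient of [Mqsym a]. *)
Definition comp_monomial (a : seq nat) : monomial :=
  [fsfun i in seq_fset tt (iota 0 (size a)) => nth 0 a i | 0].

Lemma exponents_comp_monomial a : is_comp a -> exponents (comp_monomial a) = a.
Proof.
move=> ca.
have mE i : comp_monomial a i = nth 0 a i.
  rewrite fsfun_fun seq_fsetE mem_iota add0n /=.
  by case: ltnP => // h; rewrite nth_default.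
rewrite /exponents (_ : sort _ _ = iota 0 (size a)).
  by under eq_map => i do rewrite mE; exact: mkseq_nth.
apply: (sorted_eq leq_trans anti_leq).
- exact: sort_sorted leq_total _.
- exact: iota_sorted.
rewrite perm_sort; apply: uniq_perm; rewrite ?iota_uniq ?fset_uniq // => i.
rewrite mem_finsupp mE mem_iota add0n /=.
case: ltnP => h; last by rewrite nth_default ?eqxx.
by apply: contraNneq ca => <-; exact: mem_nth.
Qed.

(** Triangularity: the terms of [Fqsym a'] come from sets containing that of [a'], and a larger set
    gives a composition with more parts. *)
Lemma Fqsym_comp_monomial_neq0 a a' : is_comp a -> is_comp a' ->
  Fqsym a' (comp_monomial a) != 0%R -> a' = a \/ size a' < size a.
Proof.
move=> ca ca' h.
have [D sD eD] : exists2 D : {set 'I_(sumn a').-1},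
    set_of_comp (sumn a') a' \subset D & comp_of_set D = a.
  case: (pickP (fun D : {set 'I_(sumn a').-1} =>
    (set_of_comp (sumn a') a' \subset D) && (comp_of_set D == a))) => [D /andP[h1 /eqP h2]|no].
    by exists D.
  case/eqP: h; apply: big1 => D hD; rewrite /Mqsym exponents_comp_monomial //.
  by have := no D; rewrite hD /= eq_sym => ->.
case: (posnP (sumn a')) => [n0|n0].
  left; rewrite -eD /comp_of_set (introT eqP n0).
  by case: a' ca' n0 {h D sD eD} => //= x s; rewrite /is_comp inE negb_or => /andP[]; lia.
have := subset_leq_card sD; rewrite leq_eqVlt => /orP[/eqP e|lt].
  left; rewrite -eD -[LHS]set_of_compK //; congr comp_of_set; apply/eqP.
  by rewrite eqEcard sD e leqnn.
by right; move: lt; rewrite -ltnS -!size_comp_of_set // set_of_compK // eD.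
Qed.

Lemma Fqsym_comp_monomial a : is_comp a -> Fqsym a (comp_monomial a) = 1%R.
Proof.
move=> ca; rewrite /Fqsym (bigD1 (set_of_comp (sumn a) a)) //=.
rewrite /Mqsym exponents_comp_monomial // set_of_compK // eqxx.
rewrite big1 ?GRing.addr0 // => D /andP[sD nD].
case: eqP => // e; case/eqP: nD; apply/eqP.
case: (posnP (sumn a)) => [n0|n0].
  by apply/eqP/setP => i; have := ltn_ord i; lia.
rewrite eq_sym eqEcard sD /= -ltnS -!size_comp_of_set // set_of_compK //.
by rewrite -e.
Qed.

(* The coefficients agree by induction on the number of parts: the [F_x] with
   nonzero coefficient at the monomial of [a] have fewer parts, except [F_a]. *)
Lemma F_expansion_inj (f : series) c c' : F_expansion f c -> F_expansion f c' ->
  forall a, is_comp a -> c a = c' a.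
Proof.
move=> [cc fc] [cc' fc'] a; have [m] := ubnP (size a); elim: m a => // m IH a am ca.
pose S := (finsupp c `|` finsupp c')%fset.
have sumE (d : {fsfun seq nat -> int with 0%R}) : (finsupp d `<=` S)%fset ->
    (\sum_(x <- finsupp d) d x * Fqsym x (comp_monomial a) =
     \sum_(x <- S) d x * Fqsym x (comp_monomial a))%R.
  move=> dS; apply: big_fset_incl => // x xS xd.
  by rewrite fsfun_dflt // GRing.mul0r.
have : (\sum_(x <- S) (c x - c' x) * Fqsym x (comp_monomial a) = 0)%R.
  under eq_bigr => x _ do rewrite GRing.mulrBl.
  by rewrite GRing.sumrB -!sumE ?fsubsetUl ?fsubsetUr // -fc -fc' GRing.subrr.
case: (boolP (a \in S)) => [aS|]; last first.
  by rewrite in_fsetU negb_or => /andP[h1 h2] _; rewrite !fsfun_dflt.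
rewrite (big_fsetD1 a) //= Fqsym_comp_monomial // GRing.mulr1 big_seq big1.
  by rewrite GRing.addr0 => /eqP; rewrite GRing.subr_eq0 => /eqP.
move=> x; rewrite in_fsetD1 => /andP[xa xS].
have cx : is_comp x by move: xS; rewrite in_fsetU => /orP[/cc|/cc'].
case: (eqVneq (Fqsym x (comp_monomial a)) 0%R) => [->|]; first by rewrite GRing.mulr0.
case/(Fqsym_comp_monomial_neq0 ca cx) => [e|lt]; first by rewrite e eqxx in xa.
by rewrite IH ?GRing.subrr ?GRing.mul0r //; apply: leq_trans lt _.
Qed.

Lemma is_comp_comp_of_set n (S : {set 'I_n.-1}) : is_comp (comp_of_set S).
Proof.
rewrite (comp_of_setE (D := fun p => p \in map val (enum S))) ?is_comp_pred_comp //.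
by move=> i; rewrite mem_map ?mem_enum //; exact: val_inj.
Qed.

(** Counting tableaux by descent composition gives one expansion; by [F_expansion_inj] every other
    agrees with it on compositions. *)
Lemma F_supportE (A : skew_shape) a : F_support A a <->
  exists2 T : filling A, is_SYT T & descent_comp T = a.
Proof.
have [S SE] : exists S : {fset seq nat},
    S =i [seq descent_comp T | T <- enum [pred T : filling A | is_SYT T]].
  by exists (seq_fset tt [seq descent_comp T | T <- enum [pred T : filling A | is_SYT T]]);
    exact: seq_fsetE.
pose num a := #|[pred T : filling A | is_SYT T && (descent_comp T == a)]|.
pose c : {fsfun seq nat -> int with 0%R} := [fsfun x in S => ((num x)%:R)%R : int | 0%R].
have numS x : (0 < num x) = (x \in S).
  rewrite SE; apply/card_gt0P/mapP => [[T]|[T]].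
    by rewrite inE => /andP[h /eqP <-]; exists T => //; rewrite mem_enum.
  by rewrite mem_enum inE => h ->; exists T; rewrite inE h eqxx.
have cE x : c x = (num x)%:R%R.
  by rewrite fsfun_fun; case: ifP => //; rewrite -numS; case: (num x).
have suppc : finsupp c = S.
  apply/fsetP => x; rewrite mem_finsupp cE -numS.
  by rewrite Num.Theory.pnatr_eq0 lt0n.
have cexp : F_expansion (skew_schur A) c.
  split=> [x|m].
    by rewrite suppc SE => /mapP[T _ ->]; exact: is_comp_comp_of_set.
  rewrite suppc /skew_schur.
  under [RHS]eq_bigr => x _ do rewrite cE GRing.mulr_natl -GRing.sumr_const.
  rewrite (exchange_big_dep (@is_SYT A)) /=; last by move=> x T _ /andP[].
  apply: eq_bigr => T hT; rewrite big_mkcond (big_fsetD1 (descent_comp T)) /=.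
    rewrite inE hT eqxx big_seq big1 ?GRing.addr0 // => x.
    by rewrite in_fsetD1 inE eq_sym hT => /andP[/negbTE->].
  by rewrite -numS; apply/card_gt0P; exists T; rewrite inE hT eqxx.
have numE : (0 < num a) <-> exists2 T : filling A, is_SYT T & descent_comp T = a.
  split=> [/card_gt0P[T]|[T hT dT]]; last by apply/card_gt0P; exists T; rewrite inE hT dT eqxx.
  by rewrite inE => /andP[hT /eqP dT]; exists T.
rewrite -numE; split=> [[c' c'exp c'a]|na]; last first.
  by exists c => //; rewrite cE Num.Theory.ltr0n.
have ca : is_comp a.
  by case: c'exp => h _; apply: h; rewrite mem_finsupp; apply: contraTneq c'a => ->.
by move: c'a; rewrite (F_expansion_inj c'exp cexp ca) cE Num.Theory.ltr0n.
Qed.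

(** * Ribbons, tableaux and words *)

Local Notation orow A := (nth 0 (outer A)).
Local Notation irow A := (nth 0 (inner A)).

Lemma nth_part_nonincr la i j : is_part la -> i <= j -> nth 0 la j <= nth 0 la i.
Proof.
case/andP => sla _ ij; case: (ltnP j (size la)) => jla; last by rewrite nth_default.
apply: (sorted_leq_nth (leT := geq)) => //.
- by move=> x y z /= h1 h2; apply: leq_trans h2 h1.
- by move=> x /=.
by rewrite inE (leq_ltn_trans ij).
Qed.

Lemma mem_boxes A i j :
  ((i, j) \in boxes A) = [&& i < nrows A, irow A i <= j & j < orow A i].
Proof.
apply/allpairsPdep/idP => [[i' [j' []]]|/and3P[h1 h2 h3]].
  rewrite !mem_iota => /= h1 h2 [-> ->]; move: h1 h2; rewrite /nrows; lia.
by exists i, j; rewrite !mem_iota /=; split=> //; lia.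
Qed.

Lemma uniq_boxes A : uniq (boxes A).
Proof.
apply: allpairs_uniq_dep => [|i _|[i j] [i' j'] _ _ /= [-> ->] //]; exact: iota_uniq.
Qed.

Definition row_lengths A := mkseq (row_length A) (nrows A).

Lemma shape_sizeE A : shape_size A = sumn (row_lengths A).
Proof.
rewrite /shape_size card_seq_sub ?uniq_boxes // size_allpairs_dep.
by congr sumn; apply: eq_map => i; rewrite size_iota.
Qed.

Lemma count_between a b h : b <= h -> count (fun j => a <= j < b) (iota 0 h) = b - a.
Proof.
move=> bh; rewrite -[in RHS](minn_idPl bh).
elim: {bh} h => [|h IH]; first by rewrite minn0.
by rewrite -[in iota 0 _]addn1 iotaD count_cat IH /=; lia.
Qed.

(** Both ends of the rows move weakly left going down, so the top row bounds the common columns on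
    the left and the bottom row on the right. *)
Lemma overlapE A k i : 0 < k -> i + k <= nrows A ->
  overlap k A i = orow A (i + k.-1) - irow A i.
Proof.
move=> k0 ik; rewrite -(@count_between _ _ (head 0 (outer A))); last first.
  by rewrite -nth0; apply: nth_part_nonincr => //; exact: outer_part.
apply: eq_count => j /=; apply/allP/andP => [h|[h1 h2] l].
  have := h i; have := h (i + k.-1); rewrite !mem_iota !mem_boxes.
  by move=> /(_ ltac:(lia))/and3P[_ _ ->] /(_ ltac:(lia))/and3P[_ -> _].
rewrite mem_iota mem_boxes => /andP[il lk].
apply/and3P; split; first lia.
  by apply: leq_trans h1; apply: nth_part_nonincr => //; exact: inner_part.
by apply: leq_trans h2 _; apply: nth_part_nonincr; [exact: outer_part|lia].
Qed.

Lemma rows_part1 A : elongated_ribbon A ->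
  rows_part 1 A = sort geq (row_lengths A).
Proof.
move=> [_ long]; rewrite /rows_part addnK /row_lengths /mkseq.
have -> : map (overlap 1 A) (iota 0 (nrows A)) = map (row_length A) (iota 0 (nrows A)).
  apply/eq_in_map => i; rewrite mem_iota => /= ir.
  by rewrite overlapE ?addn0 // addn1; lia.
congr sort; apply/all_filterP; rewrite all_map; apply/allP => i.
by rewrite mem_iota => /= ir; apply: ltnW; apply: long; lia.
Qed.

Lemma rows_part2 A : ribbon A -> rows_part 2 A = nseq (nrows A).-1 1.
Proof.
move=> rib; rewrite /rows_part addn1 subSS subn1.
have -> : map (overlap 2 A) (iota 0 (nrows A).-1) = nseq (nrows A).-1 1.
  rewrite -[in RHS](size_iota 0 (nrows A).-1) -(size_map (overlap 2 A)).
  apply/all_pred1P; rewrite all_map; apply/allP => i; rewrite mem_iota => /= ir.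
  by rewrite rib //; lia.
rewrite (_ : filter _ _ = nseq (nrows A).-1 1); last first.
  by apply/all_filterP; rewrite all_nseq orbT.
apply: (@sorted_sort _ geq).
  by move=> x y z /= h1 h2; apply: leq_trans h2 h1.
by elim: (nrows A).-1 => //= -[|m] //= ->.
Qed.

Lemma ribbon_columns A i : ribbon A -> i.+1 < nrows A -> orow A i.+1 = (irow A i).+1.
Proof.
by move=> rib ir; have := rib i ir; rewrite overlapE // ?addn1 ?addn2 //; lia.
Qed.

(** Row [i.+2] ends below the first box of row [i.+1], and this is not the last box of that row, the
    only one below row [i]. Hence nonadjacent rows share no column. *)
Lemma elongated_columns A i j : elongated_ribbon A -> i.+1 < j -> j < nrows A ->
  orow A j <= irow A i.
Proof.
move=> [rib long] ij jr.
have h1 : orow A j <= orow A i.+2 by apply: nth_part_nonincr => //; exact: outer_part.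
have := ribbon_columns (i := i) rib ltac:(lia).
have := ribbon_columns (i := i.+1) rib ltac:(lia).
by have := long i.+1 ltac:(lia); rewrite /row_length; lia.
Qed.

Lemma rows_part_ge3 A k : elongated_ribbon A -> 2 < k -> rows_part k A = [::].
Proof.
move=> rib k3; rewrite /rows_part.
have -> : [seq d <- map (overlap k A) (iota 0 (nrows A + 1 - k)) | 0 < d] = [::].
  apply/eqP; rewrite -(negbK (_ == _)) -has_filter -all_predC all_map.
  apply/allP => i; rewrite mem_iota => /= ir; rewrite -leqNgt overlapE; [|lia|lia].
  by rewrite leqn0 subn_eq0 elongated_columns //; lia.
by [].
Qed.

Lemma nth_row_lengths A i : i < nrows A -> nth 0 (row_lengths A) i = row_length A i.
Proof. exact: nth_mkseq. Qed.

Lemma size_row_lengths A : size (row_lengths A) = nrows A.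
Proof. exact: size_mkseq. Qed.

Lemma box_mem A (b : box A) :
  [&& brow b < nrows A, irow A (brow b) <= bcol b & bcol b < orow A (brow b)].
Proof. by rewrite -mem_boxes /brow /bcol -surjective_pairing; exact: valP. Qed.

Lemma box_inj A (b b' : box A) : brow b = brow b' -> bcol b = bcol b' -> b = b'.
Proof.
rewrite /brow /bcol => h1 h2; apply: val_inj.
by rewrite [LHS]surjective_pairing [RHS]surjective_pairing h1 h2.
Qed.

Lemma exists_box A i j : i < nrows A -> irow A i <= j < orow A i ->
  exists b : box A, brow b = i /\ bcol b = j.
Proof.
move=> ir ij; have h : (i, j) \in boxes A by rewrite mem_boxes ir.
by exists (Sub (i, j) h); rewrite /brow /bcol SubK.
Qed.

Lemma sum_boxes A i : i < nrows A -> \sum_(b : box A) (brow b == i) = row_length A i.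
Proof.
move=> ir.
have -> : \sum_(b : box A) (brow b == i) = \sum_(x <- boxes A) (x.1 == i).
  rewrite -(big_map val xpredT (fun x => (x.1 == i) : nat)); apply: perm_big.
  apply: uniq_perm; rewrite ?uniq_boxes ?(map_inj_uniq val_inj) ?index_enum_uniq //.
  move=> x; apply/mapP/idP => [[b _ ->]|hx]; first exact: valP.
  by exists (Sub x hx); rewrite ?SubK ?mem_index_enum.
rewrite big_allpairs_dep (big_rem i) ?mem_iota //= [X in _ + X]big1_seq ?addn0.
  by rewrite eqxx /= sum1_size size_iota.
move=> j; rewrite rem_filter ?iota_uniq // mem_filter => /and3P[_ /= /negbTE ji _].
by apply: big1 => ? _; rewrite /= ji.
Qed.

(** * Passing between tableaux and words *)

Lemma descent_compE A (T : filling A) (u : nat -> nat) : bijective T ->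
  (forall b, u (T b) = brow b) ->
  descent_comp T = pred_comp (shape_size A) (fun p => u p < u p.+1).
Proof.
move=> [g gT Tg] uT; apply: comp_of_setE => i; rewrite inE.
have i1 : i < shape_size A by have := ltn_ord i; lia.
have i2 : i.+1 < shape_size A by have := ltn_ord i; lia.
apply/existsP/idP => [[b /existsP[b' /and3P[/eqP[h1] /eqP[h2] lt]]]|lt].
  by rewrite -h2 -h1 !uT.
exists (g (Ordinal i1)); apply/existsP; exists (g (Ordinal i2)).
by rewrite /entry !Tg !eqxx -!uT !Tg.
Qed.

Lemma SYT_bij A (T : filling A) : is_SYT T -> bijective T.
Proof.
case/and3P => /forallP card1 _ _; apply: inj_card_bij; last by rewrite card_ord.
move=> b b' e; have /card1P[x hx] := card1 (T b).
have := hx b; have := hx b'; rewrite !inE e !eqxx => /esym/eqP -> /esym/eqP ->; by [].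
Qed.

(** The letter at a position is the row of the corresponding entry; the two boxes in the column
    shared by rows [i] and [i.+1] give the link. *)
Lemma word_of_SYT A (T : filling A) : ribbon A -> is_SYT T ->
  exists2 u, ribbon_word (shape_size A) (row_lengths A) u &
    descent_comp T = pred_comp (shape_size A) (fun p => u p < u p.+1).
Proof.
move=> rib hT; have bijT := SYT_bij hT; have [g gT Tg] := bijT.
pose u p := if insub p is Some v then brow (g v) else 0.
have uv (v : 'I_(shape_size A)) : u v = brow (g v) by rewrite /u valK.
have uT b : u (T b) = brow b by rewrite uv gT.
exists u; last exact: descent_compE.
rewrite /ribbon_word size_row_lengths; split.
- by move=> p pn; rewrite (uv (Ordinal pn)); case/andP: (box_mem (g (Ordinal pn))).
- move=> i ir; rewrite nth_row_lengths // -sum_boxes // /occ (reindex T) /=.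
    by apply: eq_bigr => b _; rewrite uT.
  exact: onW_bij.
move=> i ir; have e := ribbon_columns rib ir.
have oo : orow A i.+1 <= orow A i by apply: nth_part_nonincr => //; exact: outer_part.
have mm : irow A i.+1 <= irow A i by apply: nth_part_nonincr => //; exact: inner_part.
have [||b [bi bj]] := @exists_box A i (irow A i); [lia|lia|].
have [||b' [bi' bj']] := @exists_box A i.+1 (irow A i); [lia|lia|].
exists (T b), (T b'); rewrite !uT; split=> //.
case/and3P: hT => _ _ /forallP/(_ b)/forallP/(_ b').
by rewrite bj bj' eqxx bi bi' ltnSn.
Qed.

Definition occurrences (n : nat) (u : nat -> nat) i := [seq p <- iota 0 n | u p == i].

Lemma size_occurrences n u i : size (occurrences n u i) = occ u i n.
Proof. by rewrite size_filter occ_count /mkseq count_map. Qed.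

Lemma mem_occurrences n u i p : (p \in occurrences n u i) = (u p == i) && (p < n).
Proof. by rewrite mem_filter mem_iota. Qed.

Lemma occurrences_sorted n u i : sorted ltn (occurrences n u i).
Proof. by apply: sorted_filter; [exact: ltn_trans|exact: iota_ltn_sorted]. Qed.

Lemma leq_nth_occurrences n u i c d : c <= d -> d < occ u i n ->
  nth 0 (occurrences n u i) c <= nth 0 (occurrences n u i) d.
Proof.
rewrite leq_eqVlt => /orP[/eqP->//|cd] dn; apply: ltnW.
apply: (sorted_ltn_nth ltn_trans) => //; first exact: occurrences_sorted.
  by rewrite inE size_occurrences (ltn_trans cd).
by rewrite inE size_occurrences.
Qed.

(** Row [i] is filled from left to right with the occurrences of [i], so rows increase at once. Two
    boxes in one column lie in adjacent rows, where the link decides. *)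
Lemma SYT_of_word A (u : nat -> nat) : elongated_ribbon A ->
  ribbon_word (shape_size A) (row_lengths A) u ->
  exists2 T : filling A, is_SYT T &
    descent_comp T = pred_comp (shape_size A) (fun p => u p < u p.+1).
Proof.
move=> rib; rewrite /ribbon_word size_row_lengths; set n := shape_size A.
move=> [ur uo lk]; have [rib2 long] := rib.
pose c (b : box A) := bcol b - irow A (brow b).
pose q (b : box A) := nth 0 (occurrences n u (brow b)) (c b).
have cb b : c b < occ u (brow b) n.
  have /and3P[h1 h2 h3] := box_mem b.
  by rewrite uo // nth_row_lengths // /c /row_length; lia.
have qin b : q b \in occurrences n u (brow b) by rewrite mem_nth ?size_occurrences.
have qn b : q b < n by have := qin b; rewrite mem_occurrences => /andP[].
have uq b : u (q b) = brow b by have := qin b; rewrite mem_occurrences => /andP[/eqP].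
pose T : filling A := [ffun b => Ordinal (qn b)].
have Tq b : T b = q b :> nat by rewrite ffunE.
have injT : injective T.
  move=> b b' /(congr1 val); rewrite /= !Tq => e.
  have eb : brow b = brow b' by rewrite -!uq e.
  apply: box_inj => //.
  have /and3P[_ h1 _] := box_mem b; have /and3P[_ h1' _] := box_mem b'.
  suff : c b = c b' by rewrite /c -eb; rewrite -eb in h1'; lia.
  move/eqP: e; rewrite /q -eb nth_uniq ?size_occurrences ?cb //; first by move/eqP.
    by rewrite eb cb.
  by rewrite filter_uniq ?iota_uniq.
have bijT : bijective T by apply: inj_card_bij => //; rewrite card_ord.
exists T; last by apply: descent_compE => // b; rewrite Tq uq.
apply/and3P; split.
- have [g gT Tg] := bijT; apply/forallP => v; apply/eqP/(@eq_card1 _ (g v)) => b.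
  by rewrite !inE -(inj_eq (can_inj Tg)) gT.
- apply/forallP => b; apply/forallP => b'; apply/implyP => /andP[/eqP eb lt].
  rewrite /entry ltnS !Tq /q -eb; apply: (sorted_ltn_nth ltn_trans).
  + exact: occurrences_sorted.
  + by rewrite inE size_occurrences.
  + by rewrite inE size_occurrences eb.
  have /and3P[_ h1 _] := box_mem b; have /and3P[_ h1' _] := box_mem b'.
  by rewrite /c -eb; rewrite -eb in h1'; lia.
apply/forallP => b; apply/forallP => b'; apply/implyP => /andP[/eqP ec lt].
have /and3P[h1 h2 h3] := box_mem b; have /and3P[h1' h2' h3'] := box_mem b'.
have eb : brow b' = (brow b).+1.
  apply/eqP; rewrite eqn_leq lt andbT leqNgt; apply/negP => far.
  by have := elongated_columns rib far h1'; lia.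
have e : orow A (brow b).+1 = (irow A (brow b)).+1.
  by apply: ribbon_columns => //; rewrite -eb.
rewrite eb e in h3'.
have [|x [y [xy yn ux uy]]] := lk (brow b); first by rewrite -eb.
(* [b] starts its row and holds the first occurrence, at or before [x]; [b'] ends its row and holds
   the last one, at or after [y]. *)
rewrite /entry ltnS !Tq; apply: leq_ltn_trans (leq_trans xy _).
  have xin : x \in occurrences n u (brow b) by rewrite mem_occurrences ux eqxx (ltn_trans xy).
  rewrite -(nth_index 0 xin) /q (_ : c b = 0); last by rewrite /c; lia.
  by apply: leq_nth_occurrences => //; rewrite -size_occurrences index_mem.
have yin : y \in occurrences n u (brow b') by rewrite mem_occurrences uy eb eqxx.
rewrite -(nth_index 0 yin) /q; apply: leq_nth_occurrences; last exact: cb.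
have : index y (occurrences n u (brow b')) < occ u (brow b') n.
  by rewrite -size_occurrences index_mem.
rewrite uo // nth_row_lengths // /row_length /c -ec; rewrite eb e; lia.
Qed.

Lemma F_support_ribbon A a : elongated_ribbon A ->
  F_support A a <-> exists2 u, ribbon_word (shape_size A) (row_lengths A) u &
    pred_comp (shape_size A) (fun p => u p < u p.+1) = a.
Proof.
move=> rib; split=> [/F_supportE[T hT <-]|[u hu <-]].
  by have [u hu ->] := word_of_SYT (proj1 rib) hT; exists u.
have [T hT <-] := SYT_of_word rib hu.
by apply/F_supportE; exists T.
Qed.

Lemma eq_pred_comp n D D' : (forall p, p.+1 < n -> D p = D' p) ->
  pred_comp n D = pred_comp n D'.
Proof.
move=> e; rewrite /pred_comp; congr (if _ then _ else pairmap _ _ (rcons (map _ _) _)).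
by apply: eq_in_filter => p; rewrite mem_iota => /= pn; apply: e; lia.
Qed.

(** * Comparing supports *)

Lemma F_support_sub A B : elongated_ribbon A -> elongated_ribbon B ->
  shape_size A = shape_size B ->
  (forall a, F_support B a -> F_support A a) <->
  (forall D, asc_realizable (shape_size B) D (row_lengths B) ->
             asc_realizable (shape_size B) D (row_lengths A)).
Proof.
move=> ribA ribB sz; split=> [sub D [v vb vD]|sub a].
  have /sub : F_support B (pred_comp (shape_size B) (fun p => v p < v p.+1)).
    by apply/F_support_ribbon => //; exists v.
  case/(F_support_ribbon _ ribA); rewrite sz => u ua e; exists u => // p pn.
  by rewrite -vD //; exact: (pred_comp_inj e).
case/(F_support_ribbon _ ribB) => v vb <-.
have [|u ua uv] := sub (fun p => v p < v p.+1); first by exists v.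
by apply/F_support_ribbon => //; rewrite sz; exists u => //; exact: eq_pred_comp.
Qed.

(** Past the length of [la] its partial sums are constant while those of [mu] do not decrease, so
    the bounds up to [size la] give all the others. *)
Lemma dom_leP la mu : sumn la = sumn mu ->
  dom_le la mu <-> forall m, psum la m <= psum mu m.
Proof.
move=> e; split=> [dom m|h k _]; last exact: h.
case: (ltnP (size la) m) => hm.
  rewrite [psum la m]/psum take_oversize ?(ltnW hm) //.
  case: (posnP (size la)) => [/size0nil->//|la0].
  have := dom (size la); rewrite la0 leqnn take_size => /(_ isT) h.
  apply: leq_trans h _; rewrite /psum -(subnKC hm) addSnnS takeD sumn_cat.
  exact: leq_addr.
by case: m hm => [|m] hm; [rewrite /psum take0|apply: dom; rewrite hm].
Qed.

Theorem theorem5p3 (A B : skew_shape)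
    (hA : elongated_ribbon A) (hB : elongated_ribbon B)
    (hsize : shape_size A = shape_size B) :
  (forall a : seq nat, F_support B a -> F_support A a) <->
  (forall k : nat, 1 <= k -> dom_le (rows_part k A) (rows_part k B)).
Proof.
have long C : elongated_ribbon C -> all (leq 2) (row_lengths C).
  by move=> [_ h]; rewrite all_map; apply/allP => i; rewrite mem_iota => /= /h.
have sum_sort s : sumn (sort geq s) = sumn s by apply: perm_sumn; rewrite perm_sort.
apply: (iff_trans (F_support_sub hA hB hsize)); rewrite shape_sizeE.
have sumAB : sumn (row_lengths A) = sumn (row_lengths B) by rewrite -!shape_sizeE.
apply: (iff_trans (asc_realizable_sub (long A hA) (long B hB) sumAB)).
rewrite !size_row_lengths.
have dom1 : dom_le (rows_part 1 A) (rows_part 1 B) <->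
    forall m, psum (sort geq (row_lengths A)) m <= psum (sort geq (row_lengths B)) m.
  by rewrite !rows_part1 //; apply: dom_leP; rewrite !sum_sort.
(* Both partitions consist of ones, so only their lengths matter. *)
have dom2 : dom_le (rows_part 2 A) (rows_part 2 B) <-> (nrows A).-1 <= (nrows B).-1.
  rewrite (rows_part2 hA.1) (rows_part2 hB.1); split=> [|le] /=.
    case: (posnP (nrows A).-1) => [->//|r0] /(_ (nrows A).-1).
    rewrite size_nseq r0 leqnn take_nseq // sumn_nseq mul1n => /(_ isT) h.
    apply: leq_trans h _; rewrite -[X in _ <= X](mul1n) -sumn_nseq.
    exact: psum_le.
  move=> k /andP[_]; rewrite size_nseq => kr.
  by rewrite !take_nseq ?(leq_trans kr).
split=> [[rAB dom] [|[|[|k]]] // _|dom].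
- exact/dom1.
- by apply/dom2; lia.
- rewrite (rows_part_ge3 (A := A)) // => k' /=; lia.
split; last by apply/dom1/dom.
(* If [B] has no rows, the truncated predecessors do not compare the numbers of rows; equal sizes
   and rows of length at least two then leave [A] without rows. *)
case: (posnP (nrows B)) => [rB|]; last by have := proj1 dom2 (dom 2 isT); lia.
have : row_lengths B = [::] by apply/size0nil; rewrite size_row_lengths.
move=> e; move: sumAB (long A hA); rewrite e -size_row_lengths.
by case: (row_lengths A) => //= x s; lia.
Qed.
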